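(* Let $G$ be a partial cube and let $G'$ be a contraction of $G$. (i) $G'$ is a partial cube. (ii) If $G$ is finite, then $\dim_I(G')=\dim_I(G)-1$.
   Context: Graphs are simple, undirected, nonempty, and not necessarily finite; $d$ is the shortest-path distance. For a set $X$, the hypercube $\mathcal H(X)$ is the graph whose vertices are the finite subsets of $X$, with $P,Q$ adjacent iff $|P\Delta Q|=1$; its dimension is $|X|$. A graph is a partial cube if it can be isometrically embedded (i.e. by a map preserving shortest-path distances) into some $\mathcal H(X)$. The isometric dimension $\dim_I(G)$ of a partial cube $G$ is the minimum possible dimension of a hypercube into which $G$ is isometrically embeddable. For an edge $ab$ of a connected graph $G=(V,E)$ put $W_{ab}=\{w\in V:d(w,a)<d(w,b)\}$, $F_{ab}=\{uv\in E:u\in W_{ab},v\in W_{ba}\}$, $U_{ab}=\{w\in W_{ab}: w \text{ is adjacent to a vertex in } W_{ba}\}$, and define $U_{ba}$ symmetrically; $\langle U\rangle$ denotes the subgraph induced by $U$. Contraction: let $ab$ be an edge of a connected graph $G$ such that $W_{ab}$ and $W_{ba}$ are convex (contain all shortest paths between their vertices) and partition $V$, and such that $F_{ab}$ is a matching defining an isomorphism between $\langle U_{ab}\rangle$ and $\langle U_{ba}\rangle$ (in a partial cube every edge has these properties). The contraction of $G$ defined by $ab$ is the graph obtained from $\langle W_{ab}\rangle$ and $\langle W_{ba}\rangle$ by pasting them along $\langle U_{ab}\rangle$ and $\langle U_{ba}\rangle$, i.e. from their disjoint union by identifying the endpoints $u\in U_{ab}$ and $v\in U_{ba}$ of each edge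 $uv\in F_{ab}$ (and identifying the corresponding edges of $\langle U_{ab}\rangle$ and $\langle U_{ba}\rangle$). A contraction of $G$ is a graph arising this way for some edge $ab$. *)

(* Defs.v *)
From mathcomp Require Import all_boot.
From mathcomp Require Import boolp classical_sets functions cardinality.

Set Implicit Arguments.
Unset Strict Implicit.
Unset Printing Implicit Defensive.

Local Open Scope classical_set_scope.
Local Open Scope card_scope.

Record graph := Graph {
  vertex :> Type;
  edge : rel vertex;
  edge_sym : symmetric edge;
  edge_irr : irreflexive edge;
  vertex_inhabited : inhabited vertex
}.

Definition walk (G : graph) (x : G) (p : seq G) (y : G) : Prop :=
  path (@edge G) x p /\ last x p = y.

Definition has_walk (G : graph) (x y : G) (n : nat) : bool :=
  `[< exists p, walk x p y /\ size p = n >].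

(* [None] stands for infinity: [x] and [y] lie in different components. *)
Definition dist (G : graph) (x y : G) : option nat :=
  match pselect (exists n, has_walk x y n) with
  | left h => Some (ex_minn h)
  | right _ => None
  end.

Definition dist_lt (m n : option nat) : bool :=
  match m, n with
  | Some m', Some n' => m' < n'
  | Some _, None => true
  | None, _ => false
  end.

Definition connected (G : graph) : Prop := forall x y : G, exists p, walk x p y.

Definition finite_graph (G : graph) : Prop := finite_set [set: G].

Definition isomorphic (G H : graph) : Prop :=
  exists f : G -> H, bijective f /\ forall x y, edge (f x) (f y) = edge x y.

Definition isometrically_embeddable (G H : graph) : Prop :=
  exists f : G -> H, forall x y, dist (f x) (f y) = dist x y.

Section Hypercube.
Variable X : Type.

Definition finite_subset := {P : set X | finite_set P}.

Definition hypercube_edge : rel finite_subset :=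
  fun P Q => sval P `+` sval Q #= `I_1.

Lemma hypercube_edge_sym : symmetric hypercube_edge.
Proof. by move=> P Q; rewrite /hypercube_edge setYC. Qed.

Lemma hypercube_edge_irr : irreflexive hypercube_edge.
Proof.
move=> P; rewrite /hypercube_edge /setY setDv setU0 card_eq_sym card_eq0.
by apply/negbTE/eqP => I0; have : `I_1 0%N by []; rewrite I0.
Qed.

Definition hypercube : graph :=
  Graph hypercube_edge_sym hypercube_edge_irr
    (inhabits (exist _ set0 (finite_set0 X))).
End Hypercube.

Definition partial_cube (G : graph) : Prop :=
  exists X : Type, isometrically_embeddable G (hypercube X).

(* The isometric dimension of [G] is the cardinal of [X]. *)
Definition has_isometric_dim (G : graph) (X : Type) : Prop :=
  isometrically_embeddable G (hypercube X) /\
  forall Y : Type, isometrically_embeddable G (hypercube Y) ->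
    [set: X] #<= [set: Y].

Section Contraction.
Variable G : graph.

Definition shortest_path (x : G) (p : seq G) (y : G) : Prop :=
  walk x p y /\ dist x y = Some (size p).

Definition convex (S : set G) : Prop :=
  forall x y p, S x -> S y -> shortest_path x p y ->
    all (fun w => w \in S) p.

Definition W (a b : G) : set G := [set w | dist_lt (dist w a) (dist w b)].

(* Each edge of [F_ab] is recorded once, oriented from [W a b] to [W b a]. *)
Definition F (a b u v : G) : Prop := [/\ edge u v, W a b u & W b a v].

Definition U (a b : G) : set G :=
  [set w | W a b w /\ exists2 v, W b a v & edge w v].

Record contractible (a b : G) : Prop := Contractible {
  contractible_connected : connected G;
  contractible_edge : edge a b;
  contractible_convex_l : convex (W a b);
  contractible_convex_r : convex (W b a);
  contractible_partition : W a b `|` W b a = setT /\ W a b `&` W b a = set0;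
  contractible_matching :
    forall u v u' v', F a b u v -> F a b u' v' -> (u = u' <-> v = v');
  contractible_iso : exists phi : G -> G,
    [/\ set_bij (U a b) (U b a) phi,
        forall u u', U a b u -> U a b u' -> edge (phi u) (phi u') = edge u u'
      & forall u v, F a b u v <-> U a b u /\ v = phi u]
}.

Variables (a b : G) (ctr : contractible a b).

(* Disjoint union of the two induced subgraphs. *)
Definition piece : Type := (W a b + W b a)%type.

Definition piece_edge (x y : piece) : bool :=
  match x, y with
  | inl u, inl u' => edge (val u) (val u')
  | inr v, inr v' => edge (val v) (val v')
  | _, _ => false
  end.

Definition glued (x y : piece) : Prop :=
  match x, y with
  | inl u, inr v | inr v, inl u => F a b (val u) (val v)
  | _, _ => x = y
  end.

(* Since [F_ab] is a matching, [glued] is an equivalence relation; the vertices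
   of the contraction are its classes. *)
Definition pasted_vertex : Type :=
  {C : set piece | exists x, C = [set y | glued x y]}.

Definition pasted_edge : rel pasted_vertex :=
  fun C D => `[< exists x y, [/\ sval C x, sval D y & piece_edge x y] >].

Lemma piece_edge_sym : symmetric piece_edge.
Proof. by move=> [u|v] [u'|v'] //=; rewrite edge_sym. Qed.

Lemma pasted_edge_sym : symmetric pasted_edge.
Proof.
move=> C D; apply: asbool_equiv_eq.
by split=> -[x [y [Cx Dy xy]]]; exists y, x; rewrite piece_edge_sym.
Qed.

Lemma pasted_edge_irr : irreflexive pasted_edge.
Proof.
move=> [C [z Cz]]; apply/negbTE/asboolP => -[x [y []]] /=; rewrite {}Cz /=.
have mat := contractible_matching ctr.
case: z x y => [w|w] [u|v] [u'|v'] //=.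
- by move=> -[<-] [<-]; rewrite edge_irr.
- by move=> wv wv'; rewrite ((mat _ _ _ _ wv wv').1 erefl) edge_irr.
- by move=> uw u'w; rewrite ((mat _ _ _ _ uw u'w).2 erefl) edge_irr.
- by move=> -[<-] [<-]; rewrite edge_irr.
Qed.

Lemma pasted_vertex_inhabited : inhabited pasted_vertex.
Proof.
have [x] : inhabited piece.
  have [g] := vertex_inhabited G.
  have : [set: G] g by [].
  rewrite -(contractible_partition ctr).1 => -[] /mem_set gW.
  - by constructor; left; exists g.
  - by constructor; right; exists g.
by constructor; exists [set y | glued x y]; exists x.
Qed.

Definition contraction_graph : graph :=
  Graph pasted_edge_sym pasted_edge_irr pasted_vertex_inhabited.
End Contraction.

Definition is_contraction (G G' : graph) : Prop :=
  exists (a b : G) (ctr : contractible a b),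
    isomorphic G' (contraction_graph ctr).

(* Main.v *)
Require Import Defs.
From mathcomp Require Import all_boot.
From mathcomp Require Import boolp classical_sets functions cardinality.

(** Let [f] embed [G] isometrically into the hypercube on [X].  Every edge [uv]
    flips exactly one coordinate, its direction.  If [i] is the direction of
    [ab], then [W a b] and [W b a] are the two sides of coordinate [i], and
    [F a b] is the set of edges of direction [i]; so the contraction identifies
    the ends of these edges, and deleting coordinate [i] from [f] gives a map
    on it.  A geodesic of [G] whose ends differ in [i] loses an edge when
    projected, hence this map is again isometric.

    For the dimension, call [f] irredundant if each coordinate is the direction
    of some edge.  Two edges have the same direction in an embedding iff the
    ends of one are separated by the direction of the other, that is by its set
    [W], which does not depend on the embedding; so sending the directions of
    an irredundant embedding to those of any other embedding is injective, and
    the dimension of an irredundant embedding is minimal.  Discarding unused coordinates makes any embedding irredundant,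
    and deleting [i] preserves irredundancy. *)

Set Implicit Arguments.
Unset Strict Implicit.
Unset Printing Implicit Defensive.

Local Open Scope classical_set_scope.
Local Open Scope card_scope.

(** * Symmetric differences and finite cardinals *)

Lemma in_setY T (A B : set T) x : (A `+` B) x <-> ~ (A x <-> B x).
Proof.
by rewrite /setY /=; case: (pselect (A x)); case: (pselect (B x)); tauto.
Qed.

Lemma setYCA T (A B C : set T) : (A `+` C) `+` (A `+` B) = C `+` B.
Proof. by rewrite (setYC A C) -setYA (setYA A) setYK set0Y. Qed.

Lemma setY_eq0 T (A B : set T) : A `+` B = set0 -> A = B.
Proof. by move=> AB; rewrite -[LHS]setY0 -(setYK B) setYA AB set0Y. Qed.

Lemma setY1_in T (A : set T) j : A j -> A `+` [set j] = A `\ j.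
Proof.
move=> Aj; rewrite /setY; apply/seteqP; split=> x /=; last tauto.
by case=> -[] // ->.
Qed.

Lemma card_setD1 T (A : set T) j n : A #= `I_n.+1 -> A j -> A `\ j #= `I_n.
Proof.
move=> An Aj; have /finite_setP[m Am] : finite_set (A `\ j).
  by apply: finite_setD; exists n.+1.
have Am1 : A #= `I_m.+1 by apply/eq_cardSP; exists j.
suff -> : n = m by [].
by apply/succn_inj/card_eq_II; rewrite -(card_eql An).
Qed.

Lemma card_setY1 T (A : set T) j n : A #= `I_n -> ~ A j ->
  A `+` [set j] #= `I_n.+1.
Proof.
move=> An nAj; have Yj : (A `+` [set j]) j by right.
apply/eq_cardSP; exists j => //.
by rewrite -setY1_in // -setYA setYK setY0.
Qed.

Lemma card1_set1 T (A : set T) : A #= `I_1 -> exists j, A = [set j].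
Proof.
case/eq_cardSP=> j Aj; rewrite II0 card_eq0 => /eqP A0; exists j.
apply/seteqP; split=> [x Ax|x ->//]; apply: contrapT => xj.
by have : (A `\ j) x by []; rewrite A0.
Qed.

Lemma finite_set_enum T (S : set T) n : S #= `I_n ->
  exists2 phi : 'I_n -> T, injective phi & range phi = S.
Proof.
(* Either [T] is empty, which forces [n = 0] and the empty map, or it is pointed. *)
elim/Ppointed: T S => T S Sn.
  move: Sn; rewrite emptyE => /eqP n0.
  case: n n0 => [_|n n0]; last by have : `I_n.+1 0%N by []; rewrite n0.
  exists (fun i : 'I_0 => match notF (ltn_ord i) with end) => [[]//|].
  by rewrite [LHS]empty_eq0 [RHS]empty_eq0.
have /card_set_bijP[phi [phiS phi_inj phi_surj]] : [set: 'I_n] #= S.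
  by rewrite card_eq_sym (card_eql Sn) card_II.
exists phi; first by move=> x y; apply: phi_inj; rewrite in_setE.
by apply/seteqP; split=> // x [i _ <-]; apply: phiS.
Qed.

(** * Distances as least lengths of walks *)

Lemma distP (G : graph) (x y : G) n :
  dist x y = Some n <->
  has_walk x y n /\ forall m, has_walk x y m -> n <= m.
Proof.
rewrite /dist; case: pselect => [h|nh]; last first.
  by split=> // -[xyn _]; case: nh; exists n.
case: ex_minnP => m xym m_min; split=> [[<-]//|[xyn n_min]].
by congr Some; apply/eqP; rewrite eqn_leq m_min // n_min.
Qed.

Lemma has_walkP (G : graph) (x y : G) n :
  has_walk x y n <-> exists p, walk x p y /\ size p = n.
Proof. by split=> [/asboolP|] // h; apply/asboolP. Qed.

Lemma has_walkS (G : graph) (x y : G) n :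
  has_walk x y n.+1 <-> exists2 z, edge x z & has_walk z y n.
Proof.
split=> [/has_walkP[[|z p] [[]]] //= /andP[xz zp] py [pn]|].
  by exists z => //; apply/has_walkP; exists p.
move=> [z xz /has_walkP[p [[zp py] pn]]].
by apply/has_walkP; exists (z :: p); split; [split=> //=; rewrite xz|rewrite /= pn].
Qed.

Lemma has_walk0 (G : graph) (x y : G) : has_walk x y 0 <-> x = y.
Proof.
split=> [/has_walkP[[|? ?] [[]]] //|->].
by apply/has_walkP; exists [::].
Qed.

Lemma edge_dist (G : graph) (x y : G) : edge x y <-> dist x y = Some 1.
Proof.
split=> [xy|/distP[/has_walkS[z xz /has_walk0 <-]]//].
apply/distP; split; first by apply/has_walkS; exists y => //; apply/has_walk0.
by case=> // /has_walk0 eq_xy; rewrite eq_xy edge_irr in xy.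
Qed.

(** * Hypercube distance as the size of a symmetric difference *)

Section HypercubeDist.
Variable X : Type.
Implicit Types P Q : hypercube X.

Definition sep P Q : set X := sval P `+` sval Q.

Lemma sep_sym P Q : sep P Q = sep Q P.
Proof. by rewrite /sep setYC. Qed.

Lemma sepY P Q R : sep P Q = sep R P `+` sep R Q.
Proof. by rewrite /sep setYCA. Qed.

Lemma in_sep P Q i : sep P Q i <-> ~ (sval P i <-> sval Q i).
Proof. exact: in_setY. Qed.

Lemma sep_finite P Q : finite_set (sep P Q).
Proof. by rewrite finite_setU; split; apply/finite_setD/svalP. Qed.

Lemma card_sep P Q : exists n, sep P Q #= `I_n.
Proof. by apply/finite_setP/sep_finite. Qed.

Lemma edge_sep P Q : edge P Q -> exists j, sep P Q = [set j].
Proof. exact: card1_set1. Qed.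

(** Each edge toggles one coordinate, so it adds one element to the separating set or removes
    one. *)
Lemma walk_sep P Q n : has_walk P Q n -> exists2 k, k <= n & sep P Q #= `I_k.
Proof.
elim: n P => [|n IHn] P.
  by move=> /has_walk0 ->; exists 0 => //; rewrite /sep setYK II0.
case/has_walkS=> R PR /IHn[k kn RQk].
have [j PRj] := edge_sep PR.
have -> : sep P Q = sep R Q `+` [set j].
  by rewrite (sepY P Q R) (sep_sym R P) PRj setYC.
have [RQj|nRQj] := pselect (sep R Q j); last first.
  by exists k.+1 => //; apply: card_setY1.
case: k kn RQk => [|k] kn RQk.
  by move: RQk; rewrite II0 card_eq0 => /eqP RQ0; rewrite RQ0 in RQj.
by exists k; [rewrite ltnW // ltnW | rewrite setY1_in // (card_setD1 RQk)].
Qed.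

(** The differing coordinates are flipped one at a time. *)
Lemma sep_walk P Q n : sep P Q #= `I_n -> has_walk P Q n.
Proof.
elim: n P => [|n IHn] P.
  rewrite II0 card_eq0 => /eqP/setY_eq0 PQ; apply/has_walk0.
  by case: P Q PQ => [P fP] [Q fQ] /= PQ; apply: eq_exist.
move=> PQn; have /eq_cardSP[j PQj _] := PQn.
have fR : finite_set (sval P `+` [set j]).
  by rewrite finite_setU; split; apply: finite_setD => //; apply: svalP.
pose R : hypercube X := exist _ _ fR.
have PR : sep P R = [set j] by rewrite /sep /= setYA setYK set0Y.
apply/has_walkS; exists R.
  by rewrite /edge /= /hypercube_edge; change (sep P R #= `I_1); rewrite PR card_set1.
by apply: IHn; rewrite (sepY R Q P) PR setYC setY1_in // (card_setD1 PQn).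
Qed.

Lemma dist_sep P Q n : sep P Q #= `I_n -> dist P Q = Some n.
Proof.
move=> PQn; apply/distP; split; first exact: sep_walk.
move=> m /walk_sep[k km PQk].
by rewrite (_ : n = k) //; apply/card_eq_II; rewrite -(card_eql PQn).
Qed.
End HypercubeDist.

(** * Isometric embeddings and directions of edges *)

Definition isometric (G H : graph) (f : G -> H) :=
  forall x y, dist (f x) (f y) = dist x y.

(** Edge preservation carries walks forward, so [f] does not increase distances; the second
    hypothesis gives the reverse inequality. *)
Lemma isometric_of_walks (G : graph) X (f : G -> hypercube X) :
    (forall x y, edge x y -> edge (f x) (f y)) ->
    (forall x y n, sep (f x) (f y) #= `I_n ->
       exists2 m, m <= n & has_walk x y m) ->
  isometric f.
Proof.
move=> fE fW x y; have [n xyn] := card_sep (f x) (f y).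
have minW m : has_walk x y m -> n <= m.
  move=> xym; suff : has_walk (f x) (f y) m.
    by have /distP[_] := dist_sep xyn; apply.
  elim: m x {xyn} xym => [|m IHm] x; first by move=> /has_walk0 ->; apply/has_walk0.
  by case/has_walkS=> z xz zy; apply/has_walkS; exists (f z); [apply: fE|apply: IHm].
rewrite (dist_sep xyn); apply/esym/distP; split=> //.
have [m mn xym] := fW _ _ _ xyn.
suff -> : n = m by [].
by apply/eqP; rewrite eqn_leq mn minW.
Qed.

Section IsometricEmbedding.
Variables (G : graph) (X : Type) (f : G -> hypercube X).
Hypothesis f_iso : isometric f.

Lemma isometric_edge x y : edge x y -> exists j, sep (f x) (f y) = [set j].
Proof. by rewrite edge_dist -f_iso -edge_dist; apply: edge_sep. Qed.

Lemma isometric_dist x y n : sep (f x) (f y) #= `I_n -> dist x y = Some n.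
Proof. by move=> xyn; rewrite -f_iso; apply: dist_sep. Qed.

(** The sets separating [w] from [a] and from [b] differ by [i] alone, so the two distances differ
    by one, and [i] decides which is smaller. *)
Lemma W_sep a b i w : sep (f a) (f b) = [set i] ->
  W a b w <-> ~ sep (f w) (f a) i.
Proof.
move=> abi; have [n wan] := card_sep (f w) (f a).
have wb : sep (f w) (f b) = sep (f w) (f a) `+` [set i].
  by rewrite (sepY _ _ (f a)) abi sep_sym.
rewrite /W /= (isometric_dist wan).
have [wai|nwai] := pselect (sep (f w) (f a) i); last first.
  rewrite (isometric_dist (n := n.+1)) ?wb; last exact: card_setY1.
  by rewrite /= ltnSn; split.
case: n wan => [|n] wan.
  by move: wan; rewrite II0 card_eq0 => /eqP wa0; rewrite wa0 in wai.
rewrite (isometric_dist (n := n)) ?wb /=; last by rewrite setY1_in // (card_setD1 wan).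
by rewrite ltnNge leqW.
Qed.

(** Membership in [W a b] is read off coordinate [i]. The right-hand side is free of [f], which lets
    two embeddings be compared. *)
Lemma sep_W a b i x y : sep (f a) (f b) = [set i] ->
  sep (f x) (f y) i <-> ~ (W a b x <-> W a b y).
Proof.
move=> abi; rewrite !(W_sep _ abi) !in_sep.
by case: (pselect (sval (f x) i)); case: (pselect (sval (f y) i));
  case: (pselect (sval (f a) i)); tauto.
Qed.

Lemma isometric_walk (x y : G) : exists p, walk x p y.
Proof.
have [n xyn] := card_sep (f x) (f y).
by have /distP[/has_walkP[p [xpy _]] _] := isometric_dist xyn; exists p.
Qed.

(** Along a walk from [x] to [y], coordinate [i] must flip at some edge, and that edge flips nothing
    else. *)
Lemma sep_direction x y i : sep (f x) (f y) i ->
  exists u v, edge u v /\ sep (f u) (f v) = [set i].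
Proof.
have [p [xp <-]] := isometric_walk x y.
elim: p x xp => [|z p IHp] x /=; first by move=> _ /in_sep[].
move=> /andP[xz /IHp{}IHp] xi.
have [j xzj] := isometric_edge xz.
have [zi|nzi] := pselect (sep (f z) (f (last z p)) i); first exact: IHp.
exists x, z; split=> //; rewrite xzj.
have : sep (f x) (f z) i by move: xi nzi; rewrite !in_sep; tauto.
by rewrite xzj => ->.
Qed.

(** Coordinates outside the range of [phi] separate no two vertices, so dropping them changes no
    distance. *)
Lemma pullback_isometry Y (phi : Y -> X) : injective phi ->
    (forall x y, sep (f x) (f y) `<=` range phi) ->
  exists2 g : G -> hypercube Y, isometric g &
    forall x y, sep (g x) (g y) = phi @^-1` sep (f x) (f y).
Proof.
move=> phi_inj f_phi.
have fin x : finite_set (phi @^-1` sval (f x)).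
  by apply: finite_preimage (svalP _) => ? ? _ _ /phi_inj.
have gE x y : sep (exist _ _ (fin x)) (exist _ _ (fin y)) =
  phi @^-1` sep (f x) (f y) by [].
exists (fun x => exist _ _ (fin x)) => // x y.
have [n xyn] := card_sep (f x) (f y).
rewrite (isometric_dist xyn); apply: dist_sep; rewrite gE.
have img : phi @` (phi @^-1` sep (f x) (f y)) = sep (f x) (f y).
  apply/seteqP; split=> [_ [j ? <-]//|j xyj].
  by have [k _ kj] := f_phi _ _ _ xyj; exists k; rewrite //= kj.
rewrite -(card_eqr xyn) -[X in _ #= X]img card_eq_sym; apply: inj_card_eq.
by move=> ? ? _ _ /phi_inj.
Qed.

End IsometricEmbedding.

(** * Irredundant embeddings and isometric dimension *)

Definition irredundant (G : graph) X (f : G -> hypercube X) :=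
  forall i, exists u v, edge u v /\ sep (f u) (f v) = [set i].

Lemma irredundant_dim (G : graph) X (f : G -> hypercube X) :
  isometric f -> irredundant f -> has_isometric_dim G X.
Proof.
move=> f_iso f_irr; split=> [|Y [g g_iso]]; first by exists f.
have /choice[h hP] i : exists h : G * G * Y,
    sep (f h.1.1) (f h.1.2) = [set i] /\ sep (g h.1.1) (g h.1.2) = [set h.2].
  have [u [v [uv fuv]]] := f_irr i.
  by have [j guv] := isometric_edge g_iso uv; exists (u, v, j).
pose s i := (h i).2.
have s_inj : injective s.
  move=> i j sij; have [fi gi] := hP i; have [fj gj] := hP j.
  (* The common direction under [g] makes the [W] of the edge chosen for [i] separate the ends of
     the edge chosen for [j]; hence [i] separates them under [f], where only [j] does. *)
  suff : sep (f (h j).1.1) (f (h j).1.2) i by rewrite fj.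
  by apply/(sep_W f_iso _ _ fi)/(sep_W g_iso _ _ gi); rewrite gj.
rewrite -(card_le_eql (inj_card_eq (f := s) _)); last by move=> ? ? _ _ /s_inj.
exact: subset_card_le.
Qed.

(** * Deleting a coordinate on a quotient *)

(** Clearing coordinate [i] does not depend on the representative, so it descends to [G']. The index
    type stays [X], with [i] no longer separating anything. *)
Lemma quotient_isometry (G G' : graph) X (f : G -> hypercube X) i
    (pi : G -> G') :
    isometric f ->
    (forall C, exists w, pi w = C) ->
    (forall u v, pi u = pi v -> sval (f u) `\ i = sval (f v) `\ i) ->
    (forall u v, sep (f u) (f v) = [set i] -> edge u v -> pi u = pi v) ->
    (forall u v, ~ sep (f u) (f v) i -> edge u v -> edge (pi u) (pi v)) ->
    (forall C D, edge C D -> exists u v,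
       [/\ ~ sep (f u) (f v) i, edge u v, pi u = C & pi v = D]) ->
  exists2 f' : G' -> hypercube X, isometric f' &
    forall u v, sep (f' (pi u)) (f' (pi v)) = sep (f u) (f v) `\ i.
Proof.
move=> f_iso pi_surj pi_inj pi_flip pi_edge pi_lift.
have /choice[lift liftK] := pi_surj.
have fin C : finite_set (sval (f (lift C)) `\ i) by apply/finite_setD/svalP.
pose f' C : hypercube X := exist _ _ (fin C).
have f'E u v : sep (f' (pi u)) (f' (pi v)) = sep (f u) (f v) `\ i.
  rewrite /sep /f' /= (pi_inj _ _ (liftK (pi u))) (pi_inj _ _ (liftK (pi v))).
  apply/seteqP; split=> j; rewrite /setY /=; tauto.
exists f' => //; apply: isometric_of_walks => [C D|C D n].
  case/pi_lift=> u [v [nuvi uv <- <-]].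
  have [j uvj] := isometric_edge f_iso uv.
  change (sep (f' (pi u)) (f' (pi v)) #= `I_1).
  rewrite f'E uvj (_ : _ `\ i = [set j]) ?card_set1 //.
  apply/seteqP; split=> [k []|k ->] //; split=> //= ji.
  by apply: nuvi; rewrite uvj ji.
(* The boolean, read as 0 or 1, counts a saved step: a walk whose ends differ at [i] has an edge of
   direction [i], which [pi] collapses. *)
have project m x y : has_walk x y m ->
    exists2 k, k + `[< sep (f x) (f y) i >] <= m & has_walk (pi x) (pi y) k.
  elim: m x => [|m IHm] x.
    move=> /has_walk0 ->; exists 0; last exact/has_walk0.
    by have /asboolF -> : ~ sep (f y) (f y) i by case/in_sep.
  case/has_walkS=> z xz /IHm[k km zyk].
  have [xzi|nxzi] := pselect (sep (f x) (f z) i).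
    have [j xzj] := isometric_edge f_iso xz.
    exists k.
      by rewrite -addn1 leq_add ?leq_b1 // (leq_trans _ km) // leq_addr.
    rewrite (pi_flip _ z) // xzj; suff -> : j = i by [].
    by move: xzi; rewrite xzj => ->.
  exists k.+1; last by apply/has_walkS; exists (pi z) => //; apply: pi_edge.
  rewrite addSn ltnS; suff -> : sep (f x) (f y) i = sep (f z) (f y) i by [].
  by apply/propext; move: nxzi; rewrite !in_sep;
    case: (pselect (sval (f x) i)); case: (pselect (sval (f y) i));
    case: (pselect (sval (f z) i)); tauto.
rewrite -(liftK C) -(liftK D) f'E.
set x := lift C; set y := lift D => xyn.
(* A geodesic, of length [m], is projected: if [i] separates its ends, both [n] and the bound on [k]
   are [m] minus one; otherwise both are [m]. *)
have [m xym] := card_sep (f x) (f y).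
have /distP[/project[k km xyk] _] := isometric_dist f_iso xym.
exists k => //; move: km.
have [xyi|nxyi] := pselect (sep (f x) (f y) i).
  rewrite asboolT // addn1; case: m xym => // m xym.
  suff -> : n = m by [].
  by apply/card_eq_II; rewrite -(card_eql xyn); apply: card_setD1.
rewrite asboolF // addn0; suff -> : n = m by [].
apply/card_eq_II; rewrite -(card_eql xyn).
rewrite (_ : _ `\ i = sep (f x) (f y)) //.
by apply/seteqP; split=> [j []|j xyj] //; split=> //= ji; rewrite -ji in nxyi.
Qed.

(** * The contraction as a quotient of [G] *)

Section ContractionMap.
Variables (G : graph) (a b : G) (ctr : contractible a b).

Definition place (x : piece a b) : G :=
  match x with inl u => val u | inr v => val v end.

Lemma W_disjoint w : W a b w -> W b a w -> False.
Proof.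
by move=> aw bw; rewrite -[False]/(set0 w) -(contractible_partition ctr).2.
Qed.

Lemma W_val (c d : G) (w : W c d) : W c d (val w).
Proof. exact: set_valP. Qed.

Lemma place_inj : injective place.
Proof.
move=> [u|u] [v|v] /= uv; do ?by congr (_ _); apply: val_inj.
- by case: (W_disjoint (W_val u)); rewrite (uv : val u = val v); apply: W_val.
- by case: (W_disjoint (W_val v)); rewrite -(uv : val u = val v); apply: W_val.
Qed.

Definition pasted (x : piece a b) : contraction_graph ctr :=
  exist _ [set y | glued x y] (ex_intro _ x erefl).

(** That glued vertices have the same class rests on the matching property: each vertex has at most
    one partner under [F a b]. *)
Lemma glued_pasted x y : glued x y <-> pasted x = pasted y.
Proof.
split=> [xy|]; last first.
  move=> /(congr1 (fun C => sval C y)) /= ->.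
  by case: y => y.
have mat := contractible_matching ctr.
apply: eq_exist; apply/seteqP.
case: x y xy => [u|u] [v|v] //= => [[->]|uv|uv|[->]]; split=> -[w|w] //=.
- by case=> <-.
- by move=> uw; congr inr; apply: val_inj; apply/(mat _ _ _ _ uv uw).
- by move=> wv; congr inl; apply: val_inj; apply/(mat _ _ _ _ uv wv).
- by case=> <-.
- by move=> wu; congr inl; apply: val_inj; apply/(mat _ _ _ _ uv wu).
- by case=> <-.
- by case=> <-.
- by move=> vw; congr inr; apply: val_inj; apply/(mat _ _ _ _ uv vw).
Qed.

Lemma pastedE (C : contraction_graph ctr) x : sval C x -> pasted x = C.
Proof.
case: C => C [y Cy] /=; rewrite [X in X x]Cy => /glued_pasted <-.
by apply: eq_exist; rewrite Cy.
Qed.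

(** Supplies the hypotheses of [quotient_isometry]; [pi] sends a vertex to the class of its copy in
    the one piece containing it. *)
Lemma contraction_map X (f : G -> hypercube X) i :
    isometric f -> sep (f a) (f b) = [set i] ->
  exists pi : G -> contraction_graph ctr,
    [/\ forall C, exists w, pi w = C,
        forall u v, pi u = pi v -> sval (f u) `\ i = sval (f v) `\ i,
        forall u v, sep (f u) (f v) = [set i] -> edge u v -> pi u = pi v,
        forall u v, ~ sep (f u) (f v) i -> edge u v -> edge (pi u) (pi v)
      & forall C D, edge C D -> exists u v,
          [/\ ~ sep (f u) (f v) i, edge u v, pi u = C & pi v = D]].
Proof.
move=> f_iso abi.
have sepW u v := sep_W f_iso u v abi.
have Wab w : W a b w \/ W b a w.
  have : [set: G] w by [].
  by rewrite -(contractible_partition ctr).1.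
have /choice[p pK] w : exists x, place x = w.
  by have [/mem_set ww|/mem_set ww] := Wab w;
    [exists (inl (exist _ w ww))|exists (inr (exist _ w ww))].
have placeK x : p (place x) = x by apply: place_inj; rewrite pK.
have F_sep u v : F a b u v -> sep (f u) (f v) = [set i].
  case=> uv uW vW; have [j uvj] := isometric_edge f_iso uv.
  suff : sep (f u) (f v) i by rewrite uvj => ->.
  by apply/sepW => -[/(_ uW) vW' _]; apply: W_disjoint vW.
have f_F u v : sep (f u) (f v) = [set i] -> sval (f u) `\ i = sval (f v) `\ i.
  move=> uvi; apply/seteqP; split=> j [/= uj ji]; split=> //;
  apply: contrapT => vj; apply: ji; suff : sep (f u) (f v) j by rewrite uvi.
    by apply/in_sep; tauto.
  by apply/in_sep; tauto.
have sideP u v : ~ sep (f u) (f v) i <->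
    (W a b u /\ W a b v) \/ (W b a u /\ W b a v).
  rewrite sepW; have := @W_disjoint u; have := @W_disjoint v.
  by have := Wab u; have := Wab v;
    case: (pselect (W a b u)); case: (pselect (W a b v)); tauto.
(* The pieces are the two sides of coordinate [i]; being induced, they keep exactly the edges of
   other directions. *)
have piece_edgeP x y : piece_edge x y <->
    edge (place x) (place y) /\ ~ sep (f (place x)) (f (place y)) i.
  rewrite sideP; case: x y => [u|u] [v|v] /=.
  - by split=> [|[]] // uv; split=> //; left; split; apply: W_val.
  - split=> // -[_ [[_ vW]|[uW _]]].
      by case: (W_disjoint vW (W_val v)).
    by case: (W_disjoint (W_val u) uW).
  - split=> // -[_ [[uW _]|[_ vW]]].
      by case: (W_disjoint uW (W_val u)).
    by case: (W_disjoint (W_val v) vW).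
  - by split=> [|[]] // uv; split=> //; right; split; apply: W_val.
exists (fun w => pasted (p w)); split.
- case=> C [x Cx]; exists (place x); rewrite placeK; apply: pastedE.
  by rewrite /= Cx; apply/glued_pasted.
- move=> u v /glued_pasted.
  rewrite -{2}(pK u) -{2}(pK v).
  case: (p u) (p v) => [x|x] [y|y] /= => [[->]//|/F_sep/f_F//|/F_sep/f_F//|[->]//].
- move=> u v uvi uv; apply/glued_pasted.
  have : sep (f u) (f v) i by rewrite uvi.
  rewrite sepW => Wuv.
  have uu := pK u; have vv := pK v.
  case: (p u) (p v) uu vv => [x|x] [y|y] /= xu yv.
  + by case: Wuv; rewrite -xu -yv; split=> _; apply: W_val.
  + by rewrite xu yv; split=> //; rewrite -?xu -?yv; apply: W_val.
  + by rewrite xu yv; split; rewrite 1?edge_sym // -?xu -?yv; apply: W_val.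
  + case: Wuv; rewrite -xu -yv.
    by split=> /W_disjoint []; apply: W_val.
- move=> u v nuvi uv; apply/asboolP; exists (p u), (p v); split.
  + by apply/glued_pasted.
  + by apply/glued_pasted.
  + by apply/piece_edgeP; rewrite !pK.
- move=> C D /asboolP[x [y [Cx Dy /piece_edgeP[xy nxyi]]]].
  exists (place x), (place y); split=> //; rewrite placeK; exact: pastedE.
Qed.
End ContractionMap.

(** * Embedding the contraction and computing its dimension *)

(** The second clause allows [i] to be removed from the index type; the third carries irredundancy
    over to the remaining coordinates. *)
Lemma contraction_embedding (G G' : graph) X (f : G -> hypercube X) :
    isometric f -> is_contraction G G' ->
  exists i (f' : G' -> hypercube X), [/\
    isometric f',
    forall C D, ~ sep (f' C) (f' D) i
    & forall j u v, j <> i -> edge u v -> sep (f u) (f v) = [set j] ->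
        exists C D, edge C D /\ sep (f' C) (f' D) = [set j]].
Proof.
move=> f_iso [a [b [ctr [h [[g hK gK] h_edge]]]]].
have [i abi] := isometric_edge f_iso (contractible_edge ctr).
have [pi [pi_surj pi_inj pi_flip pi_edge pi_lift]] := contraction_map ctr f_iso abi.
have g_edge C D : edge (g C) (g D) = edge C D by rewrite -h_edge !gK.
have [|||||f' f'_iso f'E] :=
  @quotient_isometry G G' X f i (fun w => g (pi w)) f_iso.
- by move=> C; have [w wC] := pi_surj (h C); exists w; rewrite wC.
- by move=> u v /(can_inj gK)/pi_inj.
- by move=> u v uvi /(pi_flip _ _ uvi) ->.
- by move=> u v nuvi /(pi_edge _ _ nuvi); rewrite g_edge.
- move=> C D; rewrite -h_edge => /pi_lift[u [v [nuvi uv uC vD]]].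
  by exists u, v; rewrite uC vD !hK.
exists i, f'; split=> //.
- move=> C D; have [u uC] := pi_surj (h C); have [v vD] := pi_surj (h D).
  by rewrite -(hK C) -(hK D) -uC -vD f'E => -[_]; apply.
- move=> j u v ji uv uvj; exists (g (pi u)), (g (pi v)); split.
    by rewrite g_edge; apply: pi_edge; rewrite // uvj => ij; exact/ji/esym.
  by rewrite f'E uvj; apply/seteqP; split=> [k []|k ->].
Qed.

Lemma finite_irredundant (G : graph) X (f : G -> hypercube X) :
    isometric f -> finite_graph G ->
  exists n (g : G -> hypercube 'I_n), isometric g /\ irredundant g.
Proof.
move=> f_iso finG.
pose S := [set i | exists u v, edge u v /\ sep (f u) (f v) = [set i]].
(* Every direction separates some pair of vertices; there are finitely many pairs, each with a
   finite separating set. *)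
have /finite_setP[n Sn] : finite_set S.
  apply: (@sub_finite_set _ _ (\bigcup_(u in [set: G])
    \bigcup_(v in [set: G]) sep (f u) (f v))).
    by move=> i [u [v [_ uvi]]]; exists u => //; exists v => //; rewrite uvi.
  by do 2!(apply: bigcup_finite => // ? _); apply: sep_finite.
have [phi phi_inj phiS] := finite_set_enum Sn.
have [x y j|g g_iso gE] := pullback_isometry f_iso phi_inj.
  by rewrite phiS; apply: sep_direction.
exists n, g; split=> // i.
have [u [v [uv uvi]]] : S (phi i) by rewrite -phiS; exists i.
exists u, v; split=> //; rewrite gE uvi.
by apply/seteqP; split=> [k /phi_inj|k ->].
Qed.

Theorem theorem8p5 (G G' : graph) (hG : partial_cube G)
    (hG' : is_contraction G G') :
  partial_cube G' /\
  (finite_graph G ->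
   exists n : nat,
     has_isometric_dim G (ordinal n.+1) /\ has_isometric_dim G' (ordinal n)).
Proof.
have [X [f f_iso]] := hG; split.
  have [i [f' [f'_iso _ _]]] := contraction_embedding f_iso hG'.
  by exists X, f'.
move=> /(finite_irredundant f_iso)[m [g [g_iso g_irr]]].
have [i [g' [g'_iso g'i g'_dir]]] := contraction_embedding g_iso hG'.
(* The coordinate [i] inhabits ['I_m], so [m] is a successor. *)
case: m => [|n] in g g_iso g_irr i g' g'_iso g'i g'_dir *.
  by case: i {g'i g'_dir}.
exists n; split; first exact: irredundant_dim g_irr.
(* [lift i] enumerates the coordinates other than [i], the only ones at which [g'] can separate
   vertices. *)
have [C D j CDj|k k_iso kE] := pullback_isometry g'_iso (@lift_inj _ i).
  have [l ->|ji] := unliftP i j; first by exists l.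
  by case: (g'i C D); rewrite -ji.
apply: (irredundant_dim k_iso) => j.
(* An edge of direction [lift i j], which is not [i], survives the contraction with its
   direction. *)
have [u [v [uv uvj]]] := g_irr (lift i j).
have [|C [D [CD CDj]]] := g'_dir _ _ _ _ uv uvj.
  by apply/eqP; rewrite eq_sym neq_lift.
exists C, D; split=> //; rewrite kE CDj.
by apply/seteqP; split=> [l /lift_inj|l ->].
Qed.
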